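(* For every $\lambda_\oplus$-term $M$, the Taylor support $\mathcal T(M)$ is a clique.
   Context: $\lambda_\oplus$-terms are given by $M,N,P,Q ::= x\mid\lambda x.M\mid MN\mid M\oplus N$ up to renaming of bound variables. Resource terms and monomials: $s,t ::= x\mid\lambda x.s\mid\langle s\rangle\bar t\mid s\oplus\bullet\mid\bullet\oplus s$, $\bar t ::= [t_1,\dots,t_n]$ (finite multisets of resource terms); a resource expression is a resource term or monomial. The Taylor support is defined inductively by $\mathcal T(x)=\{x\}$, $\mathcal T(\lambda x.N)=\{\lambda x.t\mid t\in\mathcal T(N)\}$, $\mathcal T(PQ)=\{\langle s\rangle[t_1,\dots,t_n]\mid n\ge0,\ s\in\mathcal T(P),\ t_1,\dots,t_n\in\mathcal T(Q)\}$, $\mathcal T(P\oplus Q)=\{s\oplus\bullet\mid s\in\mathcal T(P)\}\cup\{\bullet\oplus t\mid t\in\mathcal T(Q)\}$ (it is the support of the Taylor expansion of $M$). The coherence relation $\asymp$ on resource expressions is defined inductively: $x\asymp x$; $\lambda x.s\asymp\lambda x.s'$ if $s\asymp s'$; $\langle s\rangle\bar t\asymp\langle s'\rangle\bar t'$ if $s\asymp s'$ and $\bar t\asymp\bar t'$; $[t_1,\dots,t_n]\asymp[t_{n+1},\dots,t_{n+m}]$ if $t_i\asymp t_j$ for all $1\le i,j\le n+m$; $s\oplus\bullet\asymp s'\oplus\bullet$ and $\bullet\oplus s\asymp\bullet\oplus s'$ if $s\asymp s'$; and $s\oplus\bullet\asymp\bullet\oplus s'$ for all $s,s'$ (the relation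 is symmetric). A clique is a set $E$ of resource expressions such that $e\asymp e'$ for all $e,e'\in E$. *)

(* Defs.v *)
From HB Require Import structures.
From mathcomp Require Import all_boot finmap multiset.
From mathcomp Require Import classical_sets.

Set Implicit Arguments.
Unset Strict Implicit.
Unset Printing Implicit Defensive.

Local Open Scope nat_scope.
Local Open Scope classical_set_scope.

(** Terms up to renaming of bound variables are de Bruijn terms: [LVar n]
    refers to the [n]-th enclosing abstraction (counted from 0, innermost
    first), and to a free variable when there are at most [n] of them. Resource
    terms follow the same convention. *)
Inductive lterm : Type :=
  | LVar of nat
  | LLam of lterm
  | LApp of lterm & lterm
  | LPlus of lterm & lterm.

(** Resource terms whose monomials are lists. [PInl p] is [p (+) *] and
    [PInr p] is [* (+) p]. Multisets cannot be nested directly in an inductive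
    type; the type [rterm] below selects one preterm in each class modulo
    permutation of the lists, at any depth. *)
Inductive preterm : Type :=
  | PVar of nat
  | PLam of preterm
  | PApp of preterm & seq preterm
  | PInl of preterm
  | PInr of preterm.

Definition preterm_ind' (P : preterm -> Prop)
    (HVar : forall n, P (PVar n))
    (HLam : forall p, P p -> P (PLam p))
    (HApp : forall p ps,
       P p -> foldr (fun q => and (P q)) True ps -> P (PApp p ps))
    (HInl : forall p, P p -> P (PInl p))
    (HInr : forall p, P p -> P (PInr p)) : forall p, P p :=
  fix F (p : preterm) : P p :=
  match p with
  | PVar n => HVar n
  | PLam q => HLam q (F q)
  | PApp q qs => HApp q qs (F q)
      ((fix loop (qs : seq preterm) : foldr (fun q => and (P q)) True qs :=
        match qs with
        | [::] => I
        | r :: rs => conj (F r) (loop rs)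
        end) qs)
  | PInl q => HInl q (F q)
  | PInr q => HInr q (F q)
  end.

Fixpoint preterm_code (p : preterm) : GenTree.tree nat :=
  match p with
  | PVar n => GenTree.Leaf n
  | PLam q => GenTree.Node 0 [:: preterm_code q]
  | PApp q qs => GenTree.Node 1 (preterm_code q :: map preterm_code qs)
  | PInl q => GenTree.Node 2 [:: preterm_code q]
  | PInr q => GenTree.Node 3 [:: preterm_code q]
  end.

Fixpoint preterm_decode (t : GenTree.tree nat) : preterm :=
  match t with
  | GenTree.Leaf n => PVar n
  | GenTree.Node 0 (u :: _) => PLam (preterm_decode u)
  | GenTree.Node 1 (u :: us) =>
      PApp (preterm_decode u) (map preterm_decode us)
  | GenTree.Node 2 (u :: _) => PInl (preterm_decode u)
  | GenTree.Node 3 (u :: _) => PInr (preterm_decode u)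
  | _ => PVar 0
  end.

Lemma preterm_codeK : cancel preterm_code preterm_decode.
Proof.
elim/preterm_ind' => //= [p ->|p ps -> IH|p ->|p ->] //.
by congr PApp; elim: ps IH => //= q qs IHqs [-> /IHqs ->].
Qed.

HB.instance Definition _ := Countable.copy preterm (can_type preterm_codeK).

(** An arbitrary total order on preterms, only used to choose one enumeration
    of each multiset. *)
Definition preterm_le : rel preterm := fun p q => 
  choice.pickle p <= choice.pickle q.

Lemma preterm_le_total : total preterm_le.
Proof. by move=> p q; apply: leq_total. Qed.

Lemma preterm_le_trans : transitive preterm_le.
Proof. by move=> q p r; apply: leq_trans. Qed.

Lemma preterm_le_anti : antisymmetric preterm_le.
Proof.
by move=> p q; rewrite /preterm_le -eqn_leq => /eqP; apply: (pcan_inj choice.pickleK).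
Qed.

Fixpoint canonical (p : preterm) : bool :=
  match p with
  | PVar _ => true
  | PLam q | PInl q | PInr q => canonical q
  | PApp q qs => [&& canonical q, sorted preterm_le qs & all canonical qs]
  end.

(** Resource terms. [RVar_inj], ..., [rterm_ind'] below show that this is the
    type freely generated by the constructors [RVar], [RLam], [RApp], [RInl],
    [RInr], with monomials the finite multisets of resource terms. *)
Definition rterm : Type := {p : preterm | canonical p}.

Notation monomial := {mset rterm}%mset.

Definition RVar (n : nat) : rterm := Sub (PVar n) isT.
Definition RLam (s : rterm) : rterm :=
  Sub (PLam (val s)) (valP s : canonical (PLam (val s))).
Definition RInl (s : rterm) : rterm :=
  Sub (PInl (val s)) (valP s : canonical (PInl (val s))).
Definition RInr (s : rterm) : rterm :=
  Sub (PInr (val s)) (valP s : canonical (PInr (val s))).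

Definition mono_seq (m : monomial) : seq preterm :=
  sort preterm_le (map val (enum_mset m)).

Lemma canonical_app (s : rterm) (m : monomial) :
  canonical (PApp (val s) (mono_seq m)).
Proof.
rewrite /= (valP s) (sort_sorted preterm_le_total) /=.
rewrite /mono_seq all_sort all_map; apply/allP => t _ /=; exact: valP.
Qed.

Definition RApp (s : rterm) (m : monomial) : rterm :=
  Sub (PApp (val s) (mono_seq m)) (canonical_app s m).

Lemma RVar_inj : injective RVar.
Proof. by move=> n n' /(congr1 val) []. Qed.

Lemma RLam_inj : injective RLam.
Proof. by move=> s s' /(congr1 val) /= [] /val_inj. Qed.

Lemma RInl_inj : injective RInl.
Proof. by move=> s s' /(congr1 val) /= [] /val_inj. Qed.

Lemma RInr_inj : injective RInr.
Proof. by move=> s s' /(congr1 val) /= [] /val_inj. Qed.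

Lemma mono_seq_inj : injective mono_seq.
Proof.
move=> m m' /(perm_sortP preterm_le_total preterm_le_trans preterm_le_anti).
move=> /(perm_map_inj val_inj) mm'; apply/msetP => t.
by rewrite -!count_mem_mset; move/permP: mm'.
Qed.

Lemma RApp_inj (s s' : rterm) (m m' : monomial) :
  RApp s m = RApp s' m' -> s = s' /\ m = m'.
Proof. by move=> /(congr1 val) /= [] /val_inj -> /mono_seq_inj ->. Qed.

Definition rterm_shape (s : rterm) : nat :=
  match val s with
  | PVar _ => 0 | PLam _ => 1 | PApp _ _ => 2 | PInl _ => 3 | PInr _ => 4
  end.

Lemma rterm_shapeE :
  [/\ forall n, rterm_shape (RVar n) = 0, forall s, rterm_shape (RLam s) = 1,
      forall s m, rterm_shape (RApp s m) = 2,
      forall s, rterm_shape (RInl s) = 3 & forall s, rterm_shape (RInr s) = 4].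
Proof. by []. Qed.

Lemma rterm_ind' (P : rterm -> Prop) :
  (forall n, P (RVar n)) ->
  (forall s, P s -> P (RLam s)) ->
  (forall s (m : monomial), P s -> (forall t, t \in m -> P t) ->
     P (RApp s m)) ->
  (forall s, P s -> P (RInl s)) ->
  (forall s, P s -> P (RInr s)) ->
  forall s, P s.
Proof.
move=> HVar HLam HApp HInl HInr [p].
elim/preterm_ind': p => [n|p IH|p ps IH IHs|p IH|p IH] cp.
- by rewrite (_ : exist _ _ _ = RVar n) //; apply: val_inj.
- have /= cp' := cp.
  by rewrite (_ : exist _ _ _ = RLam (Sub p cp')); [apply/HLam/IH|apply: val_inj].
- have /and3P[cq sps cps] := cp.
  pose l : seq rterm := pmap insub ps.
  have lE : map val l = ps.
    rewrite /l (pmap_filter (insubK _)); apply/all_filterP.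
    by apply/allP => q /(allP cps) cq'; rewrite insubT.
  have mE : mono_seq (seq_mset l) = ps.
    rewrite -[RHS](sorted_sort preterm_le_trans sps) -lE; apply/eqP.
    apply/eqP/(perm_sortP preterm_le_total preterm_le_trans preterm_le_anti)/perm_map.
    exact: perm_eq_seq_mset.
  rewrite (_ : exist _ _ _ = RApp (Sub p cq) (seq_mset l)); last first.
    by apply: val_inj; rewrite /= mE.
  apply: HApp => [|t]; first exact: IH.
  rewrite (perm_mem (perm_eq_seq_mset l)) => tl; have : val t \in ps by rewrite -lE map_f.
  elim: {cp sps cps l lE mE tl} ps IHs => //= q qs IHqs [Pq Pqs].
  rewrite inE => /orP[/eqP tq|/(IHqs Pqs)//].
  move: Pq; rewrite -tq => /(_ (valP t)).
  by rewrite (_ : exist _ _ _ = t) //; apply: val_inj.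
- have /= cp' := cp.
  by rewrite (_ : exist _ _ _ = RInl (Sub p cp')); [apply/HInl/IH|apply: val_inj].
- have /= cp' := cp.
  by rewrite (_ : exist _ _ _ = RInr (Sub p cp')); [apply/HInr/IH|apply: val_inj].
Qed.

Inductive rexpr : Type :=
  | ETerm of rterm
  | EMono of monomial.

Fixpoint taylor (M : lterm) : set rterm :=
  match M with
  | LVar n => [set RVar n]
  | LLam N => [set RLam t | t in taylor N]
  | LApp P Q =>
      [set r | exists s (m : monomial),
         [/\ taylor P s, forall t, t \in m -> taylor Q t & r = RApp s m]]
  | LPlus P Q =>
      [set RInl s | s in taylor P] `|` [set RInr t | t in taylor Q]
  end%classic.

(** In [coh_mono], [m `+` m'] collects [t_1, ..., t_(n+m)]; two of these may be
    the same element, so each of them is required to be coherent with itself. *)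
Inductive coh : rexpr -> rexpr -> Prop :=
  | coh_var n : coh (ETerm (RVar n)) (ETerm (RVar n))
  | coh_lam s s' :
      coh (ETerm s) (ETerm s') -> coh (ETerm (RLam s)) (ETerm (RLam s'))
  | coh_app s s' (m m' : monomial) :
      coh (ETerm s) (ETerm s') -> coh (EMono m) (EMono m') ->
      coh (ETerm (RApp s m)) (ETerm (RApp s' m'))
  | coh_mono (m m' : monomial) :
      (forall t t', t \in (m `+` m')%mset -> t' \in (m `+` m')%mset ->
         coh (ETerm t) (ETerm t')) ->
      coh (EMono m) (EMono m')
  | coh_inl s s' :
      coh (ETerm s) (ETerm s') -> coh (ETerm (RInl s)) (ETerm (RInl s'))
  | coh_inr s s' :
      coh (ETerm s) (ETerm s') -> coh (ETerm (RInr s)) (ETerm (RInr s'))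
  | coh_inl_inr s s' : coh (ETerm (RInl s)) (ETerm (RInr s'))
  | coh_inr_inl s s' : coh (ETerm (RInr s)) (ETerm (RInl s')).

Lemma coh_sym e e' : coh e e' -> coh e' e.
Proof.
elim=> *; try by constructor.
by apply: coh_mono => t t'; rewrite msetDC => ? ?; auto.
Qed.

Definition clique (E : set rexpr) : Prop :=
  forall e e', E e -> E e' -> coh e e'.

(* Main.v *)
Require Import Defs.
From mathcomp Require Import all_boot finmap multiset.
From mathcomp Require Import classical_sets.

Local Open Scope classical_set_scope.

(** Induction on [M]: two elements of its support share their head constructor, with arguments from
    the supports of the immediate subterms, except on opposite sides of a sum, where coherence is
    unconditional. *)

Lemma taylor_coh (M : lterm) (s s' : rterm) :
  taylor M s -> taylor M s' -> coh (ETerm s) (ETerm s').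
Proof.
elim: M s s' => [n|N IH|P IHP Q IHQ|P IHP Q IHQ] s s' /=.
- by move=> -> ->; apply: coh_var.
- by move=> [t Nt <-] [t' Nt' <-]; apply: coh_lam; apply: IH.
- move=> [p [m [Pp Qm ->]]] [p' [m' [Pp' Qm' ->]]].
  apply: coh_app; first exact: IHP.
  (* Both bags draw from the support of [Q], so [IHQ], which holds for arbitrary pairs, also covers
     two elements of the same bag. *)
  have Qmm' t : t \in (m `+` m')%mset -> taylor Q t.
    by rewrite in_msetD => /orP[/Qm|/Qm'].
  by apply: coh_mono => t t' /Qmm' Qt /Qmm'; apply: IHQ.
- move=> [] [t Mt <-] [] [t' Mt' <-].
  + by apply: coh_inl; apply: IHP.
  + exact: coh_inl_inr.
  + exact: coh_inr_inl.
  + by apply: coh_inr; apply: IHQ.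
Qed.

Theorem theorem4p3 (M : lterm) : clique [set ETerm t | t in taylor M].
Proof.
by move=> _ _ [s Ms <-] [s' Ms' <-]; apply: taylor_coh Ms Ms'.
Qed.
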